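(* Let $L\in(0,\infty)$, $\mu\in(-\infty,L)$, let $f\in\mathcal{F}_{\mu,L}(\mathbb{R}^n)$, let $x^\star$ be the unique global minimizer of $f$ over $\mathbb{R}^n$, let $x^1\in\mathbb{R}^n$ and let $X=\{x: f(x)\le f(x^1)\}$. If $X$ is star convex at $x^\star$, then: (i) If $f$ is $(\gamma,\mu_s)$-quasar-convex on $X$ with respect to $x^\star$, with $\gamma\in(0,1]$ and $\mu_s>0$, then $f$ has a quadratic gradient growth on $X$ with $\mu_g=\tfrac{\mu_s\gamma}{2}+\tfrac{\mu_s\gamma^2}{4}$. (ii) If $f$ has a quadratic gradient growth on $X$ with constant $\mu_g>0$, then for each $\ell\in\left(\max\left(\tfrac L2,\mu_g\right),\infty\right)$, $f$ is $(\gamma,\mu_s)$-quasar-convex on $X$ with respect to $x^\star$ with $\mu_s=\ell-\tfrac L2$ and $\gamma=\tfrac{\mu_g}{\ell}$. (iii) If $f$ is $(\gamma,\mu_s)$-quasar-convex on $X$ with respect to $x^\star$, with $\gamma\in(0,1]$ and $\mu_s>0$, then $f$ satisfies the Polyak-Łojasiewicz inequality on $X$ with $\mu_p=\mu_s\gamma^2$.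
   Context: $\|\cdot\|$, $\langle\cdot,\cdot\rangle$ are the Euclidean norm and inner product, $f^\star=\inf_{x\in\mathbb{R}^n}f(x)=f(x^\star)$. $\mathcal{F}_{\mu,L}(\mathbb{R}^n)$ denotes the set of differentiable functions $f:\mathbb{R}^n\to\mathbb{R}$ such that both $\tfrac{L}{2}\|\cdot\|^2-f$ and $f-\tfrac{\mu}{2}\|\cdot\|^2$ are convex. A set $X$ is star convex at $x^\star$ if $\lambda x+(1-\lambda)x^\star\in X$ for all $x\in X$ and $\lambda\in[0,1]$. For $\gamma\in(0,1]$ and $\mu_s\ge0$, $f$ is $(\gamma,\mu_s)$-quasar-convex on $X$ with respect to the minimizer $x^\star$ if $f(x)+\tfrac1\gamma\langle\nabla f(x),x^\star-x\rangle+\tfrac{\mu_s}{2}\|x^\star-x\|^2\le f^\star$ for all $x\in X$. Since the minimizer is unique, quadratic gradient growth on $X$ with constant $\mu_g>0$ means: $\langle\nabla f(x),x-x^\star\rangle\ge\mu_g\|x-x^\star\|^2$ for all $x\in X$. Polyak-Łojasiewicz (PŁ) inequality on $X$ with constant $\mu_p>0$: $f(x)-f^\star\le\tfrac{1}{2\mu_p}\|\nabla f(x)\|^2$ for all $x\in X$. *)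

(* Defs.v *)
From mathcomp Require Import all_boot all_order all_algebra.
From mathcomp Require Import all_classical all_reals all_analysis.

Set Implicit Arguments.
Unset Strict Implicit.
Unset Printing Implicit Defensive.

Import Order.TTheory GRing.Theory Num.Theory.
Import numFieldNormedType.Exports.

Local Open Scope classical_set_scope.
Local Open Scope ring_scope.

Definition dotp (R : realType) (n : nat) (u v : 'rV[R]_n) : R :=
  \sum_(i < n) u 0 i * v 0 i.

(* The library norm `|x| on 'rV[R]_n is the sup norm; it induces the same
   topology, hence the same notion of differentiability. *)
Definition enorm (R : realType) (n : nat) (u : 'rV[R]_n) : R :=
  Num.sqrt (dotp u u).

Definition gradient (R : realType) (n : nat) (f : 'rV[R]_n -> R)
    (x : 'rV[R]_n) : 'rV[R]_n :=
  \row_(i < n) 'D_(delta_mx 0 i) f x.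

(* mu may be negative: f is then only weakly convex. *)
Definition F_class (R : realType) (n : nat) (mu L : R)
    (f : 'rV[R]_n -> R) : Prop :=
  [/\ forall x, differentiable f x,
      convex_function [set: 'rV[R]_n]
        (fun x : 'rV[R]_n => L / 2 * enorm x ^+ 2 - f x) &
      convex_function [set: 'rV[R]_n]
        (fun x : 'rV[R]_n => f x - mu / 2 * enorm x ^+ 2)].

Definition fstar (R : realType) (n : nat) (f : 'rV[R]_n -> R) : R :=
  inf (range f).

Definition global_minimizer (R : realType) (n : nat) (f : 'rV[R]_n -> R)
    (x : 'rV[R]_n) : Prop :=
  forall y, f x <= f y.

Definition sublevel (R : realType) (n : nat) (f : 'rV[R]_n -> R)
    (x1 : 'rV[R]_n) : set 'rV[R]_n :=
  [set x | f x <= f x1].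

Definition star_convex_at (R : realType) (n : nat) (X : set 'rV[R]_n)
    (xs : 'rV[R]_n) : Prop :=
  forall (x : 'rV[R]_n) (lambda : R), X x -> 0 <= lambda <= 1 ->
    X (lambda *: x + (1 - lambda) *: xs).

Definition quasar_convex (R : realType) (n : nat) (gamma mu_s : R)
    (f : 'rV[R]_n -> R) (X : set 'rV[R]_n) (xs : 'rV[R]_n) : Prop :=
  [/\ 0 < gamma <= 1, 0 <= mu_s &
      forall x, X x ->
        f x + gamma^-1 * dotp (gradient f x) (xs - x)
          + mu_s / 2 * enorm (xs - x) ^+ 2 <= fstar f].

(* Growth is measured from the single point xs, which stands for the
   projection of x onto the solution set when the minimizer is unique. *)
Definition quadratic_gradient_growth (R : realType) (n : nat) (mu_g : R)
    (f : 'rV[R]_n -> R) (X : set 'rV[R]_n) (xs : 'rV[R]_n) : Prop :=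
  0 < mu_g /\
  forall x, X x -> mu_g * enorm (x - xs) ^+ 2 <= dotp (gradient f x) (x - xs).

Definition PL_inequality (R : realType) (n : nat) (mu_p : R)
    (f : 'rV[R]_n -> R) (X : set 'rV[R]_n) : Prop :=
  0 < mu_p /\
  forall x, X x ->
    f x - fstar f <= (2 * mu_p)^-1 * enorm (gradient f x) ^+ 2.

(* Main.v *)
(* Along the segment from xs to x, phi t = f (xs + t (x - xs)) - f xs satisfies
   t phi' >= gamma phi + 2 c t^2 by quasar-convexity, where
   4 c = gamma mu_s |x - xs|^2; this forces the quadratic growth c <= phi 1, and
   (i) follows by inserting the growth back into the quasar-convexity inequality.
   Part (ii) combines gradient growth with the L-smooth upper bound at xs, where
   the gradient vanishes, and (iii) is Young's inequality applied to the inner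
   product term. *)

Require Import Defs.
From mathcomp Require Import all_boot all_order all_algebra.
From mathcomp Require Import all_classical all_reals all_analysis.
From mathcomp Require Import ring lra.

Import Order.TTheory GRing.Theory Num.Theory.
Import numFieldNormedType.Exports.

Local Open Scope classical_set_scope.
Local Open Scope ring_scope.

(** * Algebra of the Euclidean inner product *)

Section DotProduct.
Context {R : realType} {n : nat}.
Implicit Types (u v w : 'rV[R]_n) (a : R).

Lemma dotpC u v : dotp u v = dotp v u.
Proof. by apply: eq_bigr => i _; rewrite mulrC. Qed.

Lemma dotpDl u v w : dotp (u + v) w = dotp u w + dotp v w.
Proof.
by rewrite /dotp -big_split; apply: eq_bigr => i _; rewrite mxE mulrDl.
Qed.

Lemma dotpZl a u v : dotp (a *: u) v = a * dotp u v.
Proof.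
by rewrite /dotp mulr_sumr; apply: eq_bigr => i _; rewrite mxE mulrA.
Qed.

Lemma dotpDr u v w : dotp u (v + w) = dotp u v + dotp u w.
Proof. by rewrite dotpC dotpDl !(dotpC u). Qed.

Lemma dotpZr a u v : dotp u (a *: v) = a * dotp u v.
Proof. by rewrite dotpC dotpZl dotpC. Qed.

Lemma dotpNr u v : dotp u (- v) = - dotp u v.
Proof. by rewrite -scaleN1r dotpZr mulN1r. Qed.

Lemma dotpNl u v : dotp (- u) v = - dotp u v.
Proof. by rewrite dotpC dotpNr dotpC. Qed.

Lemma dotp_ge0 u : 0 <= dotp u u.
Proof. by apply: sumr_ge0 => i _; rewrite -expr2 sqr_ge0. Qed.

Lemma sqr_enorm u : enorm u ^+ 2 = dotp u u.
Proof. by rewrite sqr_sqrtr// dotp_ge0. Qed.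

(** Expand [0 <= dotp (u - a *: v) (u - a *: v)] and divide by [2 * a]. *)
Lemma dotp_young u v a : 0 < a ->
  dotp u v <= dotp u u / (2 * a) + a / 2 * dotp v v.
Proof.
move=> a0; have := dotp_ge0 (u - a *: v).
rewrite dotpDl !dotpDr dotpNl !dotpNr dotpNl dotpZl !dotpZr dotpZl (dotpC v u).
move=> h; have a2 : 0 < 2 * a by rewrite mulr_gt0.
rewrite -(ler_pM2l a2) mulrDr (mulrC (2 * a) (_ / _)) divfK ?gt_eqF//.
lra.
Qed.

End DotProduct.

(** * Derivatives along lines and one-variable inequalities *)

Lemma dotp_gradient {R : realType} {n : nat} (f : 'rV[R]_n -> R) x v :
  differentiable f x -> dotp (gradient f x) v = 'd f x v.
Proof.
move=> fx; rewrite {2}(row_sum_delta v) linear_sum; apply: eq_bigr => i _.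
by rewrite mxE deriveE// linearZ mulrC.
Qed.

Lemma is_derive_line {R : realType} {V : normedModType R} (f : V -> R) x v t :
  differentiable f (x + t *: v) ->
  is_derive t 1 (fun s : R => f (x + s *: v)) ('D_v f (x + t *: v)).
Proof.
move=> fx.
have E : (fun h : R =>
    h^-1 *: (((fun s : R => f (x + s *: v)) \o shift t) (h *: 1)
      - f (x + t *: v))) =
  (fun h : R => h^-1 *: ((f \o shift (x + t *: v)) (h *: v) - f (x + t *: v))).
  apply/funext => h /=; congr (_ *: (f _ - _)).
  by rewrite scalerDl [h%:A]mulr1 addrCA.
split; first by rewrite /derivable E; exact: diff_derivable.
by rewrite /derive E.
Qed.

(** The right difference quotients are nonnegative. Only one side is tested, so this also serves at
    an endpoint of an interval. *)
Lemma derive_ge0_of_local_min {R : realType} {V : normedModType R} (k : V -> R)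
    x v (d : R) : differentiable k x -> 0 < d ->
  (forall s : R, 0 < s < d -> k x <= k (x + s *: v)) -> 0 <= 'd k x v.
Proof.
move=> kx d0 kmin; have kv := diff_derivable kx (v := v).
rewrite -deriveE// /derive cvg_at_rightE//; apply: limr_ge.
  by apply: cvgP; apply: cvg_dnbhs_at_right; exact: kv.
near=> s.
have s0 : 0 < s by near: s; exact: nbhs_right_gt.
have sd : s < d by near: s; exact: nbhs_right_lt.
rewrite /= mulr_ge0 ?invr_ge0 ?(ltW s0)// subr_ge0 addrC.
by rewrite kmin ?s0.
Unshelve. all: by end_near. Qed.

Lemma is_derive_quadB {R : realType} (phi : R -> R) (df t c m : R) :
  is_derive t 1 phi df ->
  is_derive t 1 (fun s => phi s - c * s ^+ 2 - m * s) (df - 2 * c * t - m).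
Proof.
move=> Hphi; have Hid := is_derive_id t (1 : R).
have H := is_deriveB (is_deriveB Hphi (is_deriveZ c (is_deriveM Hid Hid)))
  (is_deriveZ m Hid).
refine (is_derive_eq H _).
rewrite /GRing.scale/=; ring.
Qed.

(** On [[0, 1]], [phi s + b s^2 - a s] is minimal at 0, where its derivative is [df - a]. *)
Lemma le_derive_of_quad_minorant {R : realType} (phi : R -> R) (df a b : R) :
  is_derive (0 : R) (1 : R) phi df ->
  (forall t, 0 < t <= 1 -> t * a <= phi t - phi 0 + b * t ^+ 2) -> a <= df.
Proof.
move=> Hphi H; have Hk := is_derive_quadB _ _ _ (- b) a Hphi.
have /derivable1_diffP kdiff := @ex_derive _ _ _ _ _ _ _ Hk.
suff : 0 <= df - 2 * - b * 0 - a by lra.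
rewrite -(@derive_val _ _ _ _ _ _ _ Hk) deriveE//.
apply: derive_ge0_of_local_min kdiff ltr01 _.
move=> s /andP[s0 s1]; have := H s; rewrite s0 ltW// => /(_ isT).
rewrite [s%:A]mulr1 add0r expr0n/= !mulr0 !subr0; lra.
Qed.

Lemma quadratic_growth_of_derive {R : realType} (phi df : R -> R) (gamma c : R) :
  0 < gamma <= 1 -> 0 < c ->
  (forall t : R, 0 <= t <= 1 -> is_derive t (1 : R) phi (df t)) ->
  (forall t : R, 0 <= t <= 1 -> 0 <= phi t) ->
  (forall t : R, 0 <= t <= 1 -> gamma * phi t + 2 * c * t ^+ 2 <= t * df t) ->
  c <= phi 1.
Proof.
move=> /andP[g0 g1] c0 Hdf phi0 Hphi; rewrite leNgt; apply/negP => phi1.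
pose r (t : R) := phi t / t - c * t.
have p1 : 0 <= phi 1 by apply: phi0; lra.
(* Since phi >= 0, r t >= - c t tends to a nonnegative limit at 0, so r e > r 1
   for this e and the minimum of r on [e, 1] is not at e; but the differential
   inequality gives r' > 0 wherever r < 0. *)
pose e := (c - phi 1) / (2 * c).
have c20 : 0 < 2 * c by lra.
have e0 : 0 < e by rewrite divr_gt0//; lra.
(* Hence [- c e] is half of the negative number [r 1 = phi 1 - c], so [r e >= - c e > r 1]. *)
have ece : 2 * (c * e) = c - phi 1 by rewrite /e; field; lra.
have e1 : e < 1 by rewrite ltr_pdivrMr//; lra.
have rc : {within `[e, 1], continuous r}.
  apply: derivable_within_continuous => t; rewrite in_itv/= => /andP[et t1].
  have t0 : 0 < t by lra.
  have Ht : is_derive t (1 : R) phi (df t) by apply: Hdf; lra.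
  have tn0 : t != 0 by lra.
  apply: derivableB; last by apply: derivableM.
  by apply: derivableM => //; apply: derivableV.
have [t] := EVT_min (ltW e1) rc.
rewrite in_itv/= => /andP[et t1] rmin.
have t0 : 0 < t by lra.
have tn0 : t != 0 by lra.
have Ht : is_derive t (1 : R) phi (df t) by apply: Hdf; lra.
have rt1 : r t <= phi 1 - c.
  by have := rmin 1; rewrite in_itv/= lexx ltW// {2}/r divr1 mulr1; exact.
have te : e < t.
  rewrite lt_neqAle et andbT; apply/eqP => te; move: rt1.
  have : 0 <= phi t / t by rewrite divr_ge0 ?phi0; lra.
  rewrite /r -te; lra.
have Hk := is_derive_quadB _ _ _ c (r t) Ht.
(* phi s - c s^2 - (r t) s = s (r s - r t) is minimal at s = t on [e, 1]. *)
have kt : phi t - c * t ^+ 2 - r t * t = 0 by rewrite /r; field.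
have te0 : 0 < t - e by lra.
have /derivable1_diffP kdiff := @ex_derive _ _ _ _ _ _ _ Hk.
(* The minimum may sit at [t = 1], so only the direction -1 is tested. *)
have Hneg : 0 <= - (df t - 2 * c * t - r t).
  rewrite -(@derive_val _ _ _ _ _ _ _ Hk) deriveE// -linearN.
  apply: derive_ge0_of_local_min kdiff te0 _ => s /andP[s0 ste].
  rewrite kt; set u := t + _.
  have ue : u = t - s by rewrite /u [s *: _]mulrN1.
  have u0 : 0 < u by lra.
  have ru : r t <= r u by apply: rmin; rewrite in_itv/=; lra.
  have : r u * u = phi u - c * u ^+ 2 by rewrite /r; field; lra.
  have := ler_wpM2r (ltW u0) ru; lra.
have := Hphi t; rewrite (ltW t0) t1 => /(_ isT) Hd.
have rt0 : r t < 0 by lra.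
have rg : r t <= gamma * r t.
  have : 0 <= (1 - gamma) * - r t by apply: mulr_ge0; lra.
  lra.
(* With [Hd], this gives [gamma phi t <= t r t], whereas [gamma phi t = gamma c t^2 + gamma t r t]
   exceeds [t r t] by [rg]. *)
have : 0 <= t * - (df t - 2 * c * t - r t) by rewrite mulr_ge0// ltW.
have := ler_wpM2r (ltW t0) rg.
have : 0 < gamma * (c * t ^+ 2) by rewrite !mulr_gt0.
have : gamma * (phi t) = gamma * (c * t ^+ 2) + gamma * r t * t.
  by rewrite -mulrA -mulrDr; congr (_ * _); lra.
lra.
Qed.

(** * Smoothness and growth bounds for [f] *)

Lemma fstarE {R : realType} {n : nat} (f : 'rV[R]_n -> R) xs :
  global_minimizer f xs -> fstar f = f xs.
Proof.
move=> fmin; apply/eqP; rewrite eq_le; apply/andP; split.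
  by apply: ge_inf; [exists (f xs) => _ [y _ <-]; exact: fmin|exists xs].
by apply: lb_le_inf; [exists (f xs), xs|move=> _ [y _ <-]; exact: fmin].
Qed.

(** With [z = y - x], the convexity hypothesis on the segment reads [f (x + t z) - f x >= t (f y - f
    x) - L/2 t (1 - t) |z|^2]; comparing first-order terms at [t = 0] gives the bound. *)
Lemma smooth_upper_bound {R : realType} {n : nat} (L : R)
    (f : 'rV[R]_n -> R) (x y : 'rV[R]_n) :
  differentiable f x ->
  convex_function [set: 'rV[R]_n]
    (fun z : 'rV[R]_n => L / 2 * enorm z ^+ 2 - f z) ->
  f y <= f x + dotp (gradient f x) (y - x) + L / 2 * enorm (y - x) ^+ 2.
Proof.
move=> fx cvx; rewrite dotp_gradient//.
have fx0 : differentiable f (x + 0 *: (y - x)) by rewrite scale0r addr0.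
have := is_derive_line _ _ _ _ fx0.
rewrite [in 'D__ _ _]scale0r addr0 deriveE// => Hphi.
suff : f y - f x - L / 2 * enorm (y - x) ^+ 2 <= 'd f x (y - x) by lra.
apply: (le_derive_of_quad_minorant _ _ _ (- (L / 2 * enorm (y - x) ^+ 2)) Hphi).
move=> t /andP[t0 t1]; rewrite scale0r addr0.
have := cvx (Itv01 (ltW t0) t1) y x; rewrite !inE => /(_ I I).
rewrite convRE /=.
have -> : conv (Itv01 (ltW t0) t1) (y : convex_lmodType 'rV[R]_n) x
    = x + t *: (y - x).
  rewrite [LHS](_ : _ = t *: y + (1 - t) *: x)//.
  by rewrite scalerBl scale1r scalerBr addrCA.
rewrite /unstable.onem !sqr_enorm; set z := y - x.
have -> : y = x + z by rewrite addrC subrK.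
clearbody z => {Hphi fx0 cvx}.
rewrite !(dotpDl, dotpDr, dotpZl, dotpZr) (dotpC z x).
lra.
Qed.

Lemma quasar_convex_growth {R : realType} {n : nat} (gamma mu_s : R)
    (f : 'rV[R]_n -> R) (xs x1 : 'rV[R]_n) :
  0 < mu_s -> (forall x, differentiable f x) -> global_minimizer f xs ->
  star_convex_at (sublevel f x1) xs ->
  quasar_convex gamma mu_s f (sublevel f x1) xs ->
  forall x, sublevel f x1 x ->
    mu_s * gamma / 4 * enorm (x - xs) ^+ 2 <= f x - f xs.
Proof.
move=> mu_s0 fdiff fmin star [g01 _ qc] x Xx; have /andP[g0 g1] := g01.
rewrite sqr_enorm; set d := x - xs.
(* The case [d = 0] is split off because the one-variable lemma needs [c > 0]. *)
have := dotp_ge0 d; rewrite le_eqVlt => /orP[/eqP <-|d0].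
  by rewrite mulr0 subr_ge0.
pose phi (t : R) := f (xs + t *: d) - f xs.
have -> : f x - f xs = phi 1 by rewrite /phi scale1r [xs + d]addrC subrK.
apply: (quadratic_growth_of_derive phi (fun t => 'D_d f (xs + t *: d)) gamma)
  => //.
- by rewrite !mulr_gt0.
- move=> t _; rewrite -[X in is_derive _ _ _ X]subr0.
  exact: is_deriveB (is_derive_line _ _ _ _ (fdiff _)) (is_derive_cst (f xs) t 1).
- by move=> t _; rewrite subr_ge0.
(* Star convexity keeps the segment in the sublevel set, so quasar-convexity applies at each of its
   points. *)
move=> t t01; have Xt : sublevel f x1 (xs + t *: d).
  have := star x t Xx t01; congr (sublevel f x1 _).
  by rewrite scalerBl scale1r scalerBr addrCA.
have := qc _ Xt; rewrite (fstarE _ _ fmin) opprD addNKr sqr_enorm.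
rewrite dotpNl !dotpNr opprK dotpZl !dotpZr dotp_gradient// -deriveE//.
rewrite -(ler_pM2l g0) !mulrDr mulVKf ?gt_eqF// /phi; lra.
Qed.

Theorem theorem9 (R : realType) (n : nat) (L mu : R)
    (f : 'rV[R]_n -> R) (xs x1 : 'rV[R]_n)
    (hL : 0 < L) (hmu : mu < L)
    (hf : F_class mu L f)
    (hxs : unique (global_minimizer f) xs)
    (hX : star_convex_at (sublevel f x1) xs) :
  [/\ forall gamma mu_s : R, 0 < gamma <= 1 -> 0 < mu_s ->
        quasar_convex gamma mu_s f (sublevel f x1) xs ->
        quadratic_gradient_growth (mu_s * gamma / 2 + mu_s * gamma ^+ 2 / 4)
          f (sublevel f x1) xs,
      forall mu_g : R, 0 < mu_g ->
        quadratic_gradient_growth mu_g f (sublevel f x1) xs ->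
        forall l : R, Num.max (L / 2) mu_g < l ->
          quasar_convex (mu_g / l) (l - L / 2) f (sublevel f x1) xs &
      forall gamma mu_s : R, 0 < gamma <= 1 -> 0 < mu_s ->
        quasar_convex gamma mu_s f (sublevel f x1) xs ->
        PL_inequality (mu_s * gamma ^+ 2) f (sublevel f x1)].
Proof.
have [fdiff Lcvx _] := hf; have [fmin _] := hxs; have fsE := fstarE _ _ fmin.
split.
- move=> gamma mu_s /andP[g0 g1] mu_s0 qc; split.
    by rewrite addr_gt0// ?divr_gt0// !mulr_gt0// ?exprn_gt0.
  move=> x Xx.
  (* The growth bound times [gamma] supplies [mu_s gamma^2 / 4]; the quadratic term of
     quasar-convexity supplies [mu_s gamma / 2]. *)
  have := quasar_convex_growth _ _ _ _ _ mu_s0 fdiff fmin hX qc x Xx.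
  have [_ _ /(_ x Xx)] := qc.
  rewrite fsE -(opprB x xs) !sqr_enorm dotpNl !dotpNr opprK -(ler_pM2l g0).
  rewrite !mulrDr mulVKf ?gt_eqF// => Hq.
  rewrite -(ler_pM2l g0); lra.
- move=> mu_g mu_g0 [_ qgg] l; rewrite gt_max => /andP[lL lmu].
  have l0 : 0 < l by lra.
  split; [by rewrite divr_gt0//= ler_pdivrMr// mul1r ltW|lra|move=> x Xx].
  (* At a minimizer the differential is nonnegative along both [v] and [- v]. *)
  have grad0 v : dotp (gradient f xs) v = 0.
    rewrite dotp_gradient//; apply/eqP; rewrite eq_le -oppr_ge0 -linearN.
    by rewrite !(derive_ge0_of_local_min _ _ _ _ (fdiff xs) ltr01).
  have := smooth_upper_bound L f xs x (fdiff xs) Lcvx.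
  have := qgg x Xx; rewrite grad0 addr0 invf_div fsE -(opprB x xs).
  rewrite !sqr_enorm dotpNl !dotpNr opprK; set D := dotp (x - xs) _.
  (* Scaled by [l / mu_g], the inverse of the new [gamma], gradient growth has the lower bound
     [l D]. Against the upper bound [L/2 D] on [f x - f xs] this leaves [- (l - L/2) D], and half of
     that is enough. *)
  rewrite -(ler_pM2l (divr_gt0 l0 mu_g0)) mulrA divfK ?gt_eqF//.
  have : 0 <= (l - L / 2) * D by rewrite mulr_ge0 ?dotp_ge0//; lra.
  lra.
- move=> gamma mu_s /andP[g0 g1] mu_s0 [_ _ qc]; split.
    by rewrite mulr_gt0// exprn_gt0.
  move=> x Xx; have := qc x Xx.
  rewrite fsE -(opprB x xs) !sqr_enorm dotpNl !dotpNr opprK.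
  (* With parameter [mu_s gamma], division by [gamma] turns the Young term in [x - xs] into exactly
     the quadratic term of quasar-convexity, and the two cancel. *)
  have := dotp_young (gradient f x) (x - xs) _ (mulr_gt0 mu_s0 g0).
  have gV0 : 0 < gamma^-1 by rewrite invr_gt0.
  rewrite -(ler_pM2l gV0) mulrDr.
  have -> : gamma^-1 * (dotp (gradient f x) (gradient f x) / (2 * (mu_s * gamma)))
     = (2 * (mu_s * gamma ^+ 2))^-1 * dotp (gradient f x) (gradient f x).
    by field; rewrite !gt_eqF.
  have -> : gamma^-1 * (mu_s * gamma / 2 * dotp (x - xs) (x - xs))
     = mu_s / 2 * dotp (x - xs) (x - xs) by field; rewrite gt_eqF.
  lra.
Qed.
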